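(* Let $p\ge2$, let $\mathfrak{h}=(V,E)$ be a connected $p$-uniform hypergraph and let $\pi$ be a partition of its vertex set $V$. Let $T=(T^{(N)})_{N\ge1}$ be a sequence of heavy-Wigner tensors of order $p$ with parameters $(M_k)_{k\ge 2}$ (and $M_1=0$). Then $$\lim_{N\to\infty}\mathbb{E}\left[\mathrm{tr}^0_{\mathfrak{h}^\pi}(T^{(N)})\right]=\mathbf{1}_{\{\mathfrak{h}^\pi\text{ is a fat hypertree}\}}\prod_{r\ge1}M_r^{q_r},$$ where, when $\mathfrak{h}^\pi$ is a fat hypertree, $(q_r)_{r\ge1}$ denotes its type (with the convention $0^0=1$).
   Context: Heavy-Wigner tensors: a sequence of heavy-Wigner tensors of order $p$ with parameters $(M_k)_{k\ge2}$ is a sequence $(T^{(N)})_{N\ge1}$ of real random tensors $T^{(N)}=(T_{i_1,\dots,i_p})_{1\le i_1,\dots,i_p\le N}$ that are symmetric (invariant under permutation of the indices), whose entries indexed by $i_1\le\cdots\le i_p$ are independent (not necessarily identically distributed), such that $\mathbb{E}[T_{i_1,\dots,i_p}]=0$ for all indices (set $M_1=0$), for every $k\ge2$ one has $\sup_{i_1,\dots,i_p}N^{p-1}\mathbb{E}[T_{i_1,\dots,i_p}^k]=O(1)$ as $N\to\infty$, and for all $i_1<\cdots<i_p$ and every $k\ge2$, $N^{p-1}\mathbb{E}[T_{i_1,\dots,i_p}^k]\to M_k$ as $N\to\infty$. Hypergraphs: a hypergraph $(V,E)$ has a finite vertex set $V$ and a finite multiset $E$ of hyperedges, each hyperedge being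 a multiset of vertices. It is $p$-uniform if each hyperedge has $p$ vertices counted with multiplicity. Its incidence bipartite graph has vertex set $V\sqcup E$, with as many edges between $v$ and $e$ as the multiplicity of $v$ in $e$; the hypergraph is connected if this graph is. A hypergraph is simple if hyperedges are not repeated and each consists of pairwise distinct vertices. A hypertree is a simple hypergraph whose incidence bipartite graph is a tree. A fat hypertree is a hypergraph such that forgetting the multiplicities of hyperedges yields a hypertree; its type is $(q_r)_{r\ge1}$ where $q_r$ is the number of distinct hyperedges occurring with multiplicity exactly $r$. For a partition $\pi$ of $V$, $\mathfrak{h}^\pi$ is the hypergraph obtained from $\mathfrak{h}$ by identifying vertices in the same block of $\pi$ (keeping all hyperedges, with multiplicity). Traces: for a symmetric tensor $T$ of order $p$ and dimension $N$ and a connected $p$-uniform hypergraph $\mathfrak{g}$, $$\mathrm{Tr}^0_{\mathfrak{g}}(T)=\sum_{\phi:V(\mathfrak{g})\to[N]\text{ injective}}\ \prod_{e=\{v_1,\dots,v_p\}\in E(\mathfrak{g})}T_{\phi(v_1),\dots,\phi(v_p)},\qquad \mathrm{tr}^0_{\mathfrak{g}}(T)=\frac1N\mathrm{Tr}^0_{\mathfrak{g}}(T).$$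
   Formalization: The convergence N^{p-1}E[T_{i_1,...,i_p}^k] → M_k is assumed uniformly over i_1<...<i_p≤N; with convergence only at each fixed index tuple the claim is false (entries with an index above N/2 could have other limiting moments). *)

(* Defs.v *)
From HB Require Import structures.
From mathcomp Require Import all_boot all_order all_algebra.
From mathcomp Require Import finmap multiset.
From mathcomp Require Import all_classical all_reals all_analysis.

Set Implicit Arguments.
Unset Strict Implicit.
Unset Printing Implicit Defensive.
Import Order.TTheory GRing.Theory Num.Theory.
Import numFieldNormedType.Exports.
Local Open Scope classical_set_scope.
Local Open Scope ring_scope.

(* The multiset of hyperedges is encoded as a finite family: hyperedges       *)
(* e <> e' with [hedge e = hedge e'] are two copies of the same hyperedge.    *)
Record hypergraph : Type := Hypergraph {
  hvertex : finType;
  hedge_idx : finType;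
  hedge : hedge_idx -> {mset hvertex}%mset
}.

Definition uniform (p : nat) (g : hypergraph) : Prop :=
  forall e : hedge_idx g, size (hedge e) = p.

(* Number of edges between two nodes of the incidence bipartite graph.        *)
Definition incidence (g : hypergraph) (x y : hvertex g + hedge_idx g) : nat :=
  match x, y with
  | inl v, inr e => hedge e v
  | inr e, inl v => hedge e v
  | _, _ => 0
  end.

Definition incidence_adj (g : hypergraph) : rel (hvertex g + hedge_idx g) :=
  fun x y => (0 < incidence x y)%N.

(* The empty graph is not connected.                                          *)
Definition connected_hypergraph (g : hypergraph) : Prop :=
  (0 < #|{: hvertex g + hedge_idx g}|)%N /\
  (forall x y, connect (@incidence_adj g) x y).

(* A tree is a connected graph without cycles. In a loopless multigraph a     *)
(* cycle is a pair of parallel edges or a cycle of pairwise distinct nodes of *)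
(* length at least 3 (for [ucycle], every edge is already a cycle of size 2). *)
Definition incidence_tree (g : hypergraph) : Prop :=
  [/\ connected_hypergraph g,
      forall x y : hvertex g + hedge_idx g, (incidence x y <= 1)%N
    & forall c, ucycle (@incidence_adj g) c -> (size c <= 2)%N].

Definition simple_hypergraph (g : hypergraph) : Prop :=
  injective (@hedge g) /\ (forall e : hedge_idx g, uniq (hedge e)).

Definition hypertree (g : hypergraph) : Prop :=
  simple_hypergraph g /\ incidence_tree g.

Definition forget_mult (g : hypergraph) : hypergraph :=
  @Hypergraph (hvertex g) (seq_sub (codom (@hedge g))) val.

Definition fat_hypertree (g : hypergraph) : Prop := hypertree (forget_mult g).

Definition edge_mult (g : hypergraph) (m : {mset hvertex g}%mset) : nat :=
  #|[set e : hedge_idx g | hedge e == m]%SET|.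

(* It vanishes for r > #|hedge_idx g|, so products over r >= 1 are finite.      *)
Definition hypertype (g : hypergraph) (r : nat) : nat :=
  #|[set e : hedge_idx (forget_mult g) | @edge_mult g (hedge e) == r]%SET|.

Section Quotient.
Variables (h : hypergraph) (Q : {set {set hvertex h}}).
Hypothesis hQ : finset.partition Q [set: hvertex h]%SET.

Lemma pblock_part_mem (v : hvertex h) : finset.pblock Q v \in Q.
Proof. by rewrite finset.pblock_mem // (finset.cover_partition hQ) finset.in_setT. Qed.

Definition block_of (v : hvertex h) : {B : {set hvertex h} | B \in Q} :=
  exist _ (finset.pblock Q v) (pblock_part_mem v).

Definition hquotient : hypergraph :=
  @Hypergraph {B : {set hvertex h} | B \in Q} (hedge_idx h)
    (fun e => seq_mset [seq block_of v | v <- hedge e]).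

End Quotient.

Section Traces.
Variables (R : realType) (p N : nat).

Definition symmetric_tensor (T : p.-tuple 'I_N -> R) : Prop :=
  forall t u : p.-tuple 'I_N, perm_eq t u -> T t = T u.

(* The entry of T at a list of indices; the value 0 for lists of size <> p is *)
(* never used on p-uniform hypergraphs. For symmetric T the order in which    *)
(* the elements of a hyperedge are listed below is immaterial.                *)
Definition tensor_entry (T : p.-tuple 'I_N -> R) (s : seq 'I_N) : R :=
  if insub s is Some t then T t else 0.

Definition Tr0 (g : hypergraph) (T : p.-tuple 'I_N -> R) : R :=
  \sum_(phi : {ffun hvertex g -> 'I_N} | injectiveb phi)
    \prod_(e : hedge_idx g) tensor_entry T [seq phi v | v <- hedge e].

Definition tr0 (g : hypergraph) (T : p.-tuple 'I_N -> R) : R :=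
  N%:R^-1 * Tr0 g T.

End Traces.

(* Mutual independence of the X i, i in D.                                    *)
Definition mutually_independent (R : realType) (d : measure_display)
    (Om : measurableType d) (P : probability Om R) (I : finType) (D : {set I})
    (X : I -> {RV P >-> R}) : Prop :=
  forall (J : {set I}) (B : I -> set R),
    J \subset D -> (forall i, i \in J -> measurable (B i)) ->
    P (\bigcap_(i in [set` J]) (X i @^-1` B i)) =
    (\prod_(i in J) P (X i @^-1` B i))%E.

(* Each T^(N) may live on its own probability space, and N = 0 carries no     *)
(* information since there are no indices. Moments take values in \bar R, so  *)
(* the centering and bound fields force the relevant moments to exist.        *)
(* The convergence to M_k is uniform over i_1 < ... < i_p <= N: convergence   *)
(* at fixed indices alone would say nothing about the entries with indices of *)
(* order N, which carry most of the weight of the trace.                      *)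
Record heavy_wigner (R : realType) (p : nat) (M : nat -> R)
    (d : nat -> measure_display) (Om : forall N, measurableType (d N))
    (P : forall N, probability (Om N) R)
    (T : forall N, p.-tuple 'I_N -> {RV (P N) >-> R}) : Prop := {
  hw_param1 : M 1%N = 0;
  hw_sym : forall N w, symmetric_tensor (fun t => T N t w);
  hw_indep : forall N,
    mutually_independent
      [set t : p.-tuple 'I_N | sorted leq [seq val i | i <- t]]%SET (T N);
  hw_centered : forall N t, ('E_(P N)[T N t] = 0)%E;
  hw_bound : forall k, (2 <= k)%N ->
    exists C : R, \forall N \near \oo, forall t,
      (`| ((N%:R ^+ p.-1)%R%:E * 'E_(P N)[fun w => (T N t w ^+ k)%R])%E | <= C%:E)%E;
  hw_moments : forall k, (2 <= k)%N ->
    forall eps : R, 0 < eps -> \forall N \near \oo, forall t : p.-tuple 'I_N,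
      sorted ltn [seq val i | i <- t] ->
      (`| ((N%:R ^+ p.-1)%R%:E * 'E_(P N)[fun w => (T N t w ^+ k)%R] - (M k)%:E)%E |
         <= eps%:E)%E
}.

(* Main.v *)
Require Import Defs.

(** For injective phi the entry of T attached to a hyperedge depends only on
    the class of equal hyperedges it belongs to, and distinct classes give
    distinct, hence independent, entries.  So the expectation of a summand of
    Tr0 is the product over the F classes f of E[T_f ^ m_f], with m_f the
    multiplicity of f, and each factor is O(N^-(p-1)).  There are about N^V
    injective maps, V being the number of vertices, so the normalized trace has
    order N^(V - 1 - (p-1)F).  The incidence graph of the classes is connected
    with V + F nodes and at most pF edges, so that exponent is at most 0, with
    equality iff this graph is a tree with pF edges, i.e. iff the hypergraph is
    a fat hypertree; in that case all hyperedges have distinct vertices and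
    N^(p-1) E[T_f ^ m_f] converges to M_(m_f), uniformly in phi. *)

From HB Require Import structures.
From mathcomp Require Import all_boot all_order all_algebra.
From mathcomp Require Import finmap multiset.
From mathcomp Require Import all_classical all_reals all_analysis.
From mathcomp Require Import measurable_realfun zify ring.

Set Implicit Arguments.
Unset Strict Implicit.
Unset Printing Implicit Defensive.
Import Order.TTheory GRing.Theory Num.Theory.
Import numFieldNormedType.Exports.
Local Open Scope classical_set_scope.
Local Open Scope ring_scope.

(** * Counting edges of connected graphs *)

Section Counting.
Local Open Scope nat_scope.
Variables (T : finType).
Implicit Types e : rel T.

(** Arcs are ordered pairs, so an undirected edge counts twice; hence the doublings below. *)
Definition arcs e := [set u : T * T | e u.1 u.2]%SET.

(** Take for [d] the distance to [x0] and for [f] a choice of a closer neighbour: [f] is the parent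
    map of a spanning tree rooted at [x0]. *)
Lemma connect_descent e x0 : (forall x, connect e x x0) ->
  exists (d : T -> nat) (f : T -> T),
    forall x, x != x0 -> e x (f x) /\ (d (f x) < d x)%N.
Proof.
move=> conn.
have ex x : exists n, [exists p : n.-tuple T, path e x p && (last x p == x0)].
  have /connectP [p pp lp] := conn x; exists (size p).
  by apply/existsP; exists (in_tuple p); rewrite /= pp -lp eqxx.
pose d x := ex_minn (ex x).
have step x : x != x0 -> exists y, e x y && (d y < d x)%N.
  move=> xx0; rewrite {2}/d; case: ex_minnP => n /existsP[[[|y p] /= /eqP sp]].
    by rewrite (negPf xx0).
  move=> /andP[/andP[exy pp] lp] _; exists y; rewrite exy /=.
  rewrite /d; case: ex_minnP => m _ /(_ (size p)); rewrite -sp ltnS; apply.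
  by apply/existsP; exists (in_tuple p); rewrite /= pp lp.
exists d, (fun x => odflt x [pick y | e x y && (d y < d x)%N]) => x /step[y yP].
by case: pickP => [z /andP[]//|/(_ y)]; rewrite yP.
Qed.

Section Parent.
Variables (e : rel T) (x0 : T) (d : T -> nat) (f : T -> T).
Hypothesis e_sym : symmetric e.
Hypothesis fP : forall x, x != x0 -> e x (f x) /\ (d (f x) < d x)%N.

Let up := [set (x, f x) | x in ~: [set x0]]%SET.
Let down := [set (f x, x) | x in ~: [set x0]]%SET.

(** Each node but the root gives one arc to its parent and one back. No arc is of both kinds, since
    [d] drops strictly along the former. *)
Lemma card_parent_arcs : #|up :|: down| + 2 = #|T|.*2.
Proof.
have dis : [disjoint up & down]%B.
  apply/pred0P => -[a b] /=; apply/negP => /andP[/imsetP[x]].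
  rewrite !inE => /fP[_ lx] [-> ->] /imsetP[y]; rewrite !inE => /fP[_ ly] [xE yE].
  by move: lx ly; rewrite -xE yE => l1 /(ltn_trans l1); rewrite ltnn.
rewrite cardsU disjoint_setI0// cards0 subn0.
rewrite !card_in_imset; [|by move=> x y _ _ []|by move=> x y _ _ []].
by have := cardsC [set x0]; rewrite cards1 => <-; rewrite addnn add1n doubleS addn2.
Qed.

Lemma parent_arcs_sub : up :|: down \subset arcs e.
Proof.
apply/fintype.subsetP => -[a b]; rewrite !inE /= => /orP[] /imsetP[x];
  by rewrite !inE => /fP[ex _] [-> ->]; rewrite // e_sym.
Qed.

Lemma parent_arcs_connect x : connect (fun a b => (a, b) \in up :|: down) x x0.
Proof.
have [n] := ubnP (d x); elim: n x => // n IH x; rewrite ltnS => dx.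
have [->|xx0] := eqVneq x x0; first exact: connect0.
have [_ lt] := fP xx0.
apply: connect_trans (IH (f x) (leq_trans lt dx)); apply: connect1.
by rewrite !inE; apply/orP; left; apply/imsetP; exists x => //; rewrite !inE.
Qed.

Lemma parent_arcs_sym a b : ((a, b) \in up :|: down) = ((b, a) \in up :|: down).
Proof.
rewrite !inE orbC; congr orb; apply/imsetP/imsetP => -[x xP [-> ->]];
  by exists x.
Qed.

(** An arc outside the spanning tree would close the simple tree path joining its ends into a cycle
    of at least three nodes. *)
Lemma acyclic_arcs_sub : irreflexive e ->
  (forall c, ucycle e c -> size c <= 2) -> arcs e \subset up :|: down.
Proof.
move=> e_irr acyc; apply/fintype.subsetP => -[a b]; rewrite inE /= => eab.
apply/negPn/negP => nab.
have csym : connect_sym (fun a b => (a, b) \in up :|: down).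
  by apply: sym_connect_sym => u v; exact: parent_arcs_sym.
have /connectP[p pp lp] : connect (fun a b => (a, b) \in up :|: down) b a.
  apply: connect_trans (parent_arcs_connect b) _.
  by rewrite csym; exact: parent_arcs_connect.
case/shortenP: pp lp => q qp uq _ lq {p}.
have sub : subrel (fun a b => (a, b) \in up :|: down) e.
  by move=> u v /(fintype.subsetP parent_arcs_sub); rewrite inE.
have : ucycle e (b :: q).
  by rewrite /ucycle uq andbT /= rcons_path (sub_path sub qp) -lq.
(* With one node the arc would be a loop, with two a tree arc. *)
move=> /acyc; case: q qp uq lq => [|y [|z q]] //=.
  by move=> _ _ ba; rewrite ba e_irr in eab.
by rewrite andbT => + _ ya; rewrite -ya -parent_arcs_sym (negPf nab).
Qed.

End Parent.

Lemma connected_card_arcs e : symmetric e -> (forall x y, connect e x y) ->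
  (#|T|.*2 <= #|arcs e| + 2)%N.
Proof.
move=> es conn; have [->//|/card_gt0P[x0 _]] := posnP #|T|.
have [d [f fP]] := connect_descent (conn^~ x0).
rewrite -(card_parent_arcs fP) leq_add2r subset_leq_card//.
exact: (parent_arcs_sub es fP).
Qed.

Lemma acyclic_card_arcs e : symmetric e -> irreflexive e ->
  (forall x y, connect e x y) -> (0 < #|T|)%N ->
  (forall c, ucycle e c -> size c <= 2)%N -> (#|arcs e| + 2 <= #|T|.*2)%N.
Proof.
move=> es ei conn /card_gt0P[x0 _] acyc.
have [d [f fP]] := connect_descent (conn^~ x0).
rewrite -(card_parent_arcs fP) leq_add2r subset_leq_card//.
exact: (acyclic_arcs_sub es fP).
Qed.

(* Deleting one edge of the cycle keeps the graph connected. *)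
Lemma cyclic_card_arcs e c : symmetric e -> (forall x y, connect e x y) ->
  ucycle e c -> (2 < size c)%N -> (#|T|.*2 <= #|arcs e|)%N.
Proof.
move=> es conn; case: c => [|x [|y [|z s]]]//=.
rewrite /ucycle /= => /andP[/and3P[exy eyz pz]] /and3P[].
rewrite !inE !negb_or => /and3P[xy xz xs] /andP[yz ys] _ _.
pose e' := [rel u v | [&& e u v, (u, v) != (x, y) & (u, v) != (y, x)]].
have e's : symmetric e'.
  by move=> u v /=; rewrite es; congr andb; rewrite !xpair_eqE andbC ![(v == _) && _]andbC.
(* The rest of the cycle joins [y] to [x]: its first edge goes to [z], and the others avoid [y], so
   none is the deleted edge. *)
have cyx : connect e' y x.
  apply/connectP; exists (z :: rcons s x); last by rewrite /= last_rcons.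
  rewrite /= eyz !xpair_eqE eqxx /= (eq_sym y x) (negPf xy) /= eq_sym xz /=.
  apply: (@sub_in_path _ (predC1 y) e); last exact: pz.
    move=> u v; rewrite !inE /= !xpair_eqE => /negPf -> /negPf -> ->.
    by rewrite andbF.
  rewrite /= eq_sym yz /= all_rcons /= xy; apply/allP => u us /=.
  by apply: contraNneq ys => <-.
have sub : subrel (connect e) (connect e').
  apply: connect_sub => u v euv.
  have [[-> ->]|n1] := eqVneq (u, v) (x, y).
    by rewrite (sym_connect_sym e's).
  have [[-> ->]//|n2] := eqVneq (u, v) (y, x).
  by apply: connect1; rewrite /= euv n1.
have := connected_card_arcs e's (fun u v => sub _ _ (conn u v)).
move=> /leq_trans; apply.
(* The deletion loses two arcs, which absorbs the [+ 2] of the connected bound. *)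
have xyE : [set (x, y); (y, x)]%SET \subset arcs e.
  by apply/fintype.subsetP => u; rewrite !inE => /orP[] /eqP -> //=; rewrite es.
rewrite -(cardsID [set (x, y); (y, x)]%SET (arcs e)) addnC.
rewrite (finset.setIidPr xyE) cards2 xpair_eqE (negPf xy) /= leq_add2l.
apply: subset_leq_card; apply/fintype.subsetP => -[u v]; rewrite !inE /=.
by case/and3P => -> n1 n2; rewrite negb_or n1 n2.
Qed.

End Counting.

(** * Hypertrees *)

Section Hypergraphs.
Implicit Types g : hypergraph.

(** Forgetting multiplicities and identifying vertices both induce such surjections of incidence
    graphs. *)
Lemma connected_hypergraph_image g1 g2
    (phi : hvertex g1 + hedge_idx g1 -> hvertex g2 + hedge_idx g2) :
  (forall y, exists x, y = phi x) ->
  (forall x y, incidence_adj x y -> incidence_adj (phi x) (phi y)) ->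
  connected_hypergraph g1 -> connected_hypergraph g2.
Proof.
move=> surj adj [/card_gt0P[x0 _] conn].
split=> [|x y]; first by apply/card_gt0P; exists (phi x0).
have [[a ->] [b ->]] := (surj x, surj y).
have /connectP[s + ->] := conn a b; elim: s a => /= [a _|c s IH a /andP[ac /IH]].
  exact: connect0.
exact/connect_trans/connect1/adj.
Qed.

Lemma forget_mult_connected g :
  connected_hypergraph g -> connected_hypergraph (forget_mult g).
Proof.
pose phi (x : hvertex g + hedge_idx g) :
    hvertex (forget_mult g) + hedge_idx (forget_mult g) :=
  match x with inl v => inl v | inr e => inr (SeqSub (codom_f (@hedge g) e)) end.
apply: (@connected_hypergraph_image _ _ phi).
  case=> [v|[m mP]]; first by exists (inl v).
  by have /codomP[e me] := mP; exists (inr e); congr inr; apply: val_inj.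
by case=> [v|e] [v'|e'].
Qed.

Lemma hquotient_connected h (Q : {set {set hvertex h}})
    (hQ : finset.partition Q [set: hvertex h]%SET) :
  connected_hypergraph h -> connected_hypergraph (hquotient hQ).
Proof.
pose phi (x : hvertex h + hedge_idx h) :
    hvertex (hquotient hQ) + hedge_idx (hquotient hQ) :=
  match x with inl v => inl (block_of hQ v) | inr e => inr e end.
have adj (v : hvertex h) (e : hedge_idx h) : (0 < hedge e v)%N ->
    (0 < @hedge (hquotient hQ) e (block_of hQ v))%N.
  rewrite /= -!in_mset => ve.
  by rewrite (perm_mem (perm_eq_seq_mset _)); apply/mapP; exists v.
apply: (@connected_hypergraph_image _ _ phi).
  case=> [[B BQ]|e]; last by exists (inr e).
  have /and3P[_ tI nB] := hQ.
  (* Blocks of a partition are nonempty, so each is the block of some vertex. *)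
  have [B0|[v vB]] := finset.set_0Vmem B; first by rewrite -B0 BQ in nB.
  exists (inl v); congr inl; apply: val_inj => /=.
  by rewrite (finset.def_pblock tI BQ vB).
by case=> [v|e] [v'|e'] //=; exact: adj.
Qed.

Lemma hquotient_uniform p h (Q : {set {set hvertex h}})
    (hQ : finset.partition Q [set: hvertex h]%SET) :
  uniform p h -> uniform p (hquotient hQ).
Proof.
by move=> u e; rewrite /= (perm_size (perm_eq_seq_mset _)) size_map u.
Qed.

Lemma incidence_adj_sym g : symmetric (@incidence_adj g).
Proof. by case=> [v|e] [v'|e']. Qed.

(** Here [#|hedge e|] counts the distinct vertices of [e], that is, its neighbours in the incidence
    graph. *)
Lemma card_incidence_arcs g :
  #|arcs (@incidence_adj g)| = (\sum_(e : hedge_idx g) #|hedge e|).*2.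
Proof.
have cE e : (\sum_(v : hvertex g) (0 < hedge e v) = #|hedge e|)%N.
  by rewrite -sum1_card [RHS]big_mkcond; apply: eq_bigr => v _; rewrite in_mset; case: ltnP.
have -> : #|arcs (@incidence_adj g)| = (\sum_x \sum_y @incidence_adj g x y)%N.
  rewrite pair_big /= -sum1_card [LHS]big_mkcond /=; apply: eq_bigr => -[x y] _.
  by rewrite inE /=; case: incidence_adj.
rewrite big_sumType /= -addnn; congr addn.
  under [RHS]eq_bigr do rewrite -cE; rewrite [RHS]exchange_big; apply: eq_bigr => v _.
  rewrite big_sumType /= big1 ?add0n //.
under [RHS]eq_bigr do rewrite -cE; apply: eq_bigr => e _.
rewrite big_sumType /= addnC big1 ?add0n //.
Qed.

Lemma sum_card_hedge p g : uniform p g ->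
  (\sum_(e : hedge_idx g) #|hedge e| <= p * #|hedge_idx g|
     ?= iff [forall e : hedge_idx g, uniq (hedge e)])%N.
Proof.
move=> unif; rewrite mulnC -sum_nat_const.
apply: leqif_sum => e _; rewrite -{1}(unif e); split; first exact: card_size.
by apply/eqP/card_uniqP.
Qed.

(** With V vertices and F hyperedges, connectedness requires at least V + F - 1 incident pairs, and
    uniformity allows at most pF. *)
Lemma hypergraph_card_leq p g : uniform p g -> connected_hypergraph g ->
  (#|hvertex g| + #|hedge_idx g| <= p * #|hedge_idx g| + 1)%N.
Proof.
move=> unif [_ conn].
have := connected_card_arcs (@incidence_adj_sym g) conn.
rewrite card_incidence_arcs card_sum addn2 -doubleS leq_double => /leq_trans; apply.
by rewrite addn1 ltnS sum_card_hedge.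
Qed.

(** Equality makes both bounds behind [hypergraph_card_leq] tight: hyperedges have distinct
    vertices, so there are no parallel edges, and a longer cycle would force one more edge than the
    pF available. Conversely, acyclicity bounds the number of edges from above. *)
Lemma hypertree_cardP p g : uniform p g -> connected_hypergraph g ->
  injective (@hedge g) ->
  hypertree g <-> (#|hvertex g| + #|hedge_idx g| = p * #|hedge_idx g| + 1)%N.
Proof.
move=> unif conn inj; have [n0 connect_all] := conn.
have eE := sum_card_hedge unif; split.
  move=> [[_ uniqs] [_ _ acyc]].
  have /eqP sE : (\sum_(e : hedge_idx g) #|hedge e| == p * #|hedge_idx g|)%N.
    by rewrite eE; apply/forallP.
  apply/eqP; rewrite eqn_leq hypergraph_card_leq //= -sE.
  rewrite -leq_double -card_sum addn1 doubleS -addn2 -card_incidence_arcs.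
  apply: acyclic_card_arcs => //; first exact: incidence_adj_sym.
  by case.
move=> cE.
have lb := connected_card_arcs (@incidence_adj_sym g) connect_all.
rewrite card_incidence_arcs card_sum cE addn2 addn1 -doubleS leq_double ltnS in lb.
have /eqP eqE : (\sum_(e : hedge_idx g) #|hedge e| == p * #|hedge_idx g|)%N.
  by rewrite eqn_leq lb eE.
have uniqs : forall e : hedge_idx g, uniq (hedge e).
  by apply/forallP; rewrite -eE eqE.
have mult1 (e : hedge_idx g) v : (hedge e v <= 1)%N.
  by rewrite -count_mem_mset count_uniq_mem// leq_b1.
split=> //; split=> // [[v|e] [v'|e']//=|c uc].
rewrite leqNgt; apply/negP => c3.
have := cyclic_card_arcs (@incidence_adj_sym g) connect_all uc c3.
by rewrite card_incidence_arcs eqE card_sum cE leq_double addn1 ltnn.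
Qed.

Lemma forget_mult_uniform p g : uniform p g -> uniform p (forget_mult g).
Proof. by move=> unif [m mP] /=; have /codomP[e ->] := mP. Qed.

Lemma fat_hypertree_cardP p g : uniform p g -> connected_hypergraph g ->
  fat_hypertree g <-> (#|hvertex g| + #|hedge_idx (forget_mult g)| =
                       p * #|hedge_idx (forget_mult g)| + 1)%N.
Proof.
move=> unif conn; apply: hypertree_cardP; last exact: val_inj.
  exact: forget_mult_uniform.
exact: forget_mult_connected.
Qed.

End Hypergraphs.

(** * Products of independent random variables *)

Section Independence.
Import HBNNSimple.
Context {R : realType} {d : measure_display} {Om : measurableType d}.
Variable P : probability Om R.

(** The identity extends from indicators to simple functions, then by monotone convergence to [g].
    In the application [h] is the product of the other factors and [c] its mean. *)
Lemma integral_mul_comp_indep (h X : Om -> R) (c : R) (g : R -> R) :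
  measurable_fun setT h -> (forall w, 0 <= h w) ->
  measurable_fun setT X -> 0 <= c ->
  (forall B, measurable B ->
     (\int[P]_w (h w * \1_B (X w))%:E = c%:E * P (X @^-1` B))%E) ->
  measurable_fun setT g -> (forall x, 0 <= g x) ->
  (\int[P]_w (h w * g (X w))%:E = c%:E * \int[P]_w (g (X w))%:E)%E.
Proof.
move=> mh h0 mX c0 hB mg g0.
have simple (s : {nnsfun R >-> R}) :
    (\int[P]_w (h w * s (X w))%:E = c%:E * \int[P]_w (s (X w))%:E)%E.
  pose v := fset_set (s @` setT); pose A (i : 'I_#|` v|) := s @^-1` [set v`_i].
  have v0 (i : 'I_#|` v|) : 0 <= v`_i.
    have : v`_i \in v by rewrite mem_nth.
    by rewrite in_fset_set// => /set_mem[x _ <-].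
  have mA i : measurable (A i) by exact: measurable_sfunP.
  have mAX i : measurable_fun setT (fun w => \1_(A i) (X w) : R).
    exact: (measurableT_comp (measurable_indic _)).
  (* Expansion along the level sets of [s], for a general weight [k] because it serves for both [h]
     and the constant 1. *)
  have term (k : Om -> R) : measurable_fun setT k -> (forall w, 0 <= k w) ->
      (\int[P]_w (k w * s (X w))%:E =
       \sum_(i < #|` v|) (v`_i)%:E * \int[P]_w (k w * \1_(A i) (X w))%:E)%E.
    move=> mk k0.
    have mkA i : measurable_fun setT (fun w => (k w * \1_(A i) (X w))%:E).
      by apply/measurable_EFinP; exact: measurable_funM.
    have kA0 i w : (0 <= (k w * \1_(A i) (X w))%:E)%E by rewrite lee_fin mulr_ge0.
    under eq_integral => w _.
      rewrite fimfunEord mulr_sumr -sumEFin.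
      under eq_bigr do rewrite mulrCA EFinM.
      over.
    rewrite ge0_integral_sum//=; last 2 first.
    - by move=> i; apply/measurable_funeM/mkA.
    - by move=> i w _; apply: mule_ge0; [exact: v0|exact: kA0].
    apply: eq_bigr => i _; apply: ge0_integralZl => //; last exact: v0.
      exact: mkA.
    by move=> w _; exact: kA0.
  rewrite term// (eq_integral (fun w => (1 * s (X w))%:E)); last first.
    by move=> w _; rewrite mul1r.
  rewrite (term (cst 1))// ge0_sume_distrr; last first.
    move=> i _; rewrite mule_ge0// ?lee_fin ?v0//.
    by apply: integral_ge0 => w _; rewrite lee_fin mul1r.
  apply: eq_bigr => i _; rewrite hB// muleCA; congr (_ * (_ * _))%E.
  under [RHS]eq_integral do rewrite mul1r.
  rewrite -[X in P X]setIT -integral_indic//.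
  by rewrite -[X @^-1` _]setTI; exact: mX.
have mgE : measurable_fun setT (EFin \o g) by apply/measurable_EFinP.
pose gn := nnsfun_approx measurableT mgE.
have gn_cvg x : (gn n x)%:E @[n --> \oo] --> (g x)%:E.
  by apply: (cvg_nnsfun_approx measurableT mgE) => // y _; rewrite lee_fin.
have gn_nd x : {homo (fun n => gn n x) : m n / (m <= n)%N >-> m <= n}.
  by move=> m n mn; have /lefP := nd_nnsfun_approx measurableT mgE mn; apply.
have mgnX n : measurable_fun setT (fun w => gn n (X w)).
  exact: measurableT_comp.
have mono (k : Om -> R) : measurable_fun setT k -> (forall w, 0 <= k w) ->
    (\int[P]_w (k w * gn n (X w))%:E)%E @[n --> \oo] -->
    (\int[P]_w (k w * g (X w))%:E)%E.
  move=> mk k0.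
  have limE w : (k w * g (X w))%:E = limn (fun n => (k w * gn n (X w))%:E).
    apply/esym/cvg_lim => //.
    under eq_fun do rewrite EFinM.
    by rewrite EFinM; apply: cvgeZl => //; exact: gn_cvg.
  under [X in _ --> X]eq_integral do rewrite limE.
  apply: (cvg_monotone_convergence _ (g' := fun n w => (k w * gn n (X w))%:E)) => //.
  - by move=> n; apply/measurable_EFinP; exact: measurable_funM.
  - by move=> n w _; rewrite lee_fin mulr_ge0.
  - by move=> w _ m n mn; rewrite lee_fin ler_wpM2l// gn_nd.
apply: (@cvg_unique _ (@ereal_hausdorff R) _ _ _ _ (mono h mh h0)).
rewrite (_ : (fun n => _) = (fun n => c%:E * \int[P]_w (gn n (X w))%:E)%E).
  apply: cvgeZl => //.
  have := mono (cst 1) (measurable_cst _) (fun=> ler01).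
  under eq_fun do under eq_integral do rewrite mul1r.
  by under [X in _ --> X -> _]eq_integral do rewrite mul1r.
by apply/funext => n; exact: simple.
Qed.

Section Product.
Variables (I : finType) (D J : {set I}) (X : I -> {RV P >-> R}).
Hypotheses (indepX : mutually_independent D X) (JD : J \subset D).
Implicit Types (g : I -> R -> R) (m : I -> R).

(** A product of indicators is the indicator of an intersection, whose probability mutual
    independence gives. *)
Let integral_indic_prod g m :
  (forall i, measurable_fun setT (g i)) ->
  (forall i, i \in J -> forall x, (g i x == 0) || (g i x == 1)) ->
  (forall i, i \in J -> \int[P]_w (g i (X i w))%:E = (m i)%:E)%E ->
  (\int[P]_w (\prod_(i in J) g i (X i w))%:E = (\prod_(i in J) m i)%:E)%E.
Proof.
move=> mg g01 gm; pose B i := g i @^-1` [set 1].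
have mB i : measurable (B i) by rewrite -[B i]setTI; exact: mg.
have mXB i : measurable (X i @^-1` B i).
  by rewrite -[X i @^-1` _]setTI; exact: measurable_funPT.
have gE i w : i \in J -> g i (X i w) = \1_(X i @^-1` B i) w.
  move=> iJ; rewrite indicE; have /orP[/eqP e|/eqP e] := g01 _ iJ (X i w).
    rewrite e memNset// => /= e1; move: e; rewrite e1; apply/eqP.
    exact: oner_neq0.
  by rewrite e mem_set.
have -> : (fun w => (\prod_(i in J) g i (X i w))%:E) =
    EFin \o \1_(\bigcap_(i in [set` J]) (X i @^-1` B i)).
  apply/funext => w /=; congr EFin; rewrite indicE.
  have [/set_mem wB|wB] := boolP (w \in _).
    by apply: big1 => i iJ; rewrite gE// indicE mem_set//; exact: wB.
  have [i iJ wi] : exists2 i, i \in J & ~ (X i @^-1` B i) w.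
    apply: contrapT => nex; move/negP: wB; apply; apply/mem_set => i /= iJ.
    by apply: contrapT => nw; apply: nex; exists i.
  by rewrite (bigD1 i)//= gE// indicE memNset// mul0r.
rewrite integral_indic// ?setIT; last first.
  by apply: fin_bigcap_measurable => // i _; exact: mXB.
apply: etrans (indepX JD (B := B) (fun i _ => mB i)) _.
rewrite -prodEFin; apply: eq_bigr => i iJ; rewrite -gm//.
rewrite (eq_integral (EFin \o \1_(X i @^-1` B i))).
  by rewrite integral_indic// setIT.
by move=> w _ /=; rewrite gE.
Qed.

(* [s] lists the indices whose factor need not be an indicator function. *)
Let integral_ge0_prod (s : seq I) g m :
  (forall i, measurable_fun setT (g i)) ->
  (forall i, i \in J -> forall x, 0 <= g i x) ->
  (forall i, i \in J -> i \notin s -> forall x, (g i x == 0) || (g i x == 1)) ->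
  (forall i, i \in J -> \int[P]_w (g i (X i w))%:E = (m i)%:E)%E ->
  (\int[P]_w (\prod_(i in J) g i (X i w))%:E = (\prod_(i in J) m i)%:E)%E.
Proof.
elim: s g m => [|j s IH] g m mg g0 g01 gm.
  by apply: integral_indic_prod => // i iJ x; exact: g01.
have [jJ|jJ] := boolP (j \in J); last first.
  apply: IH => // i iJ nis x; apply: g01 => //; rewrite inE negb_or nis andbT.
  by apply: contraNneq jJ => <-.
rewrite (bigD1 j jJ) [LHS](eq_integral (fun w =>
  ((\prod_(i in J | i != j) g i (X i w)) * g j (X j w))%:E)); last first.
  by move=> w _; rewrite (bigD1 j jJ) mulrC.
rewrite (@integral_mul_comp_indep _ _ (\prod_(i in J | i != j) m i)) ?gm//.
- by rewrite -EFinM mulrC.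
- under eq_fun do rewrite -big_filter.
  by apply: measurable_prod => i _; exact: measurableT_comp.
- by move=> w; apply: prodr_ge0 => i /andP[iJ _]; exact: g0.
- apply: prodr_ge0 => i /andP[iJ _]; rewrite -lee_fin -gm//.
  by apply: integral_ge0 => w _; rewrite lee_fin g0.
- move=> B mB.
  (* With factor [j] replaced by the indicator of [B], only the indices in [s] remain exceptional
     and the induction hypothesis applies. *)
  pose g' i := if i == j then \1_B else g i.
  pose m' i := if i == j then fine (P (X j @^-1` B)) else m i.
  have mXB : measurable (X j @^-1` B).
    by rewrite -[_ @^-1` _]setTI; exact: measurable_funPT.
  rewrite [LHS](eq_integral (fun w => (\prod_(i in J) g' i (X i w))%:E)).
    rewrite (IH g' m') => [|i|i iJ x|i iJ nis x|i iJ].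
    - rewrite (bigD1 j jJ) /= {1}/m' eqxx EFinM fineK ?fin_num_measure// muleC.
      congr (_ * _)%E; congr EFin; apply: eq_bigr => i /andP[_ /negPf ij].
      by rewrite /m' ij.
    - by rewrite /g'; case: ifP => // _; exact: measurable_indic.
    - by rewrite /g'; case: ifP => // _; exact: g0.
    - rewrite /g'; case: (eqVneq i j) => [_|ij].
        by rewrite indicE; case: (x \in B); rewrite eqxx ?orbT.
      by apply: g01 => //; rewrite inE negb_or ij.
    - rewrite /g' /m'; case: (eqVneq i j) => [->|_]; last exact: gm.
      rewrite (eq_integral (EFin \o \1_(X j @^-1` B)))//.
      by rewrite integral_indic// setIT fineK// fin_num_measure.
  move=> w _; rewrite (bigD1 j jJ) /= mulrC {1}/g' eqxx; congr (_ * _)%:E.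
  by apply: eq_bigr => i /andP[_ /negPf ij]; rewrite /g' ij.
- exact: g0.
Qed.

(* [s] lists the indices whose factor may change sign. *)
Let integral_prod (s : seq I) g m :
  (forall i, measurable_fun setT (g i)) ->
  (forall i, i \in J -> i \notin s -> forall x, 0 <= g i x) ->
  (forall i, i \in J -> \int[P]_w (g i (X i w))%:E = (m i)%:E)%E ->
  (\int[P]_w (\prod_(i in J) g i (X i w))%:E = (\prod_(i in J) m i)%:E)%E.
Proof.
elim: s g m => [|j s IH] g m mg g0 gm.
  apply: (@integral_ge0_prod (enum I)) => // [i iJ x|i iJ]; first exact: g0.
  by rewrite mem_enum.
have [jJ|jJ] := boolP (j \in J); last first.
  apply: IH => // i iJ nis x; apply: g0 => //; rewrite inE negb_or nis andbT.
  by apply: contraNneq jJ => <-.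
have mgX i : measurable_fun setT (g i \o X i) by exact: measurableT_comp.
have int_of_fin (f : Om -> R) (r : R) : measurable_fun setT f ->
    (\int[P]_w (f w)%:E = r%:E)%E -> P.-integrable setT (EFin \o f).
  move=> mf fr; apply/integrableP; split; first exact/measurable_EFinP.
  by rewrite integral_fin_num_abs// fr.
have igj := int_of_fin _ _ (mgX j) (gm j jJ).
(* Factor [j] is replaced by its positive, then by its negative part. Both are nonnegative, so the
   induction hypothesis applies to each, and the results are subtracted. *)
pose gs (f : R -> R) i := if i == j then f else g i.
have sub (f : R -> R) : measurable_fun setT f -> (forall x, 0 <= f x) ->
    P.-integrable setT (EFin \o (f \o X j)) ->
    (\int[P]_w (\prod_(i in J) gs f i (X i w))%:E =
     (fine (\int[P]_w (f (X j w))%:E) * \prod_(i in J | i != j) m i)%:E)%E.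
  move=> mf f0 fint.
  pose m' i := if i == j then fine (\int[P]_w (f (X j w))%:E) else m i.
  rewrite (IH (gs f) m') => [|i|i iJ nis x|i iJ].
  - rewrite (bigD1 j jJ) /= {1}/m' eqxx; congr (_ * _)%:E.
    by apply: eq_bigr => i /andP[_ /negPf ij]; rewrite /m' ij.
  - by rewrite /gs; case: ifP.
  - rewrite /gs; case: (eqVneq i j) => [_|ij]; first exact: f0.
    by apply: g0 => //; rewrite inE negb_or ij.
  - rewrite /gs /m'; case: (eqVneq i j) => [->|_]; last exact: gm.
    by rewrite fineK//; exact: integrable_fin_num.
have mgs f : measurable_fun setT f ->
    measurable_fun setT (fun w => \prod_(i in J) gs f i (X i w)).
  move=> mf; under eq_fun do rewrite -big_filter.
  apply: measurable_prod => i _; apply: measurableT_comp => //.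
  by rewrite /gs; case: ifP.
have ip : P.-integrable setT (EFin \o ((g j)^\+ \o X j)%R).
  by have := integrable_funepos measurableT igj; rewrite -funerpos.
have im : P.-integrable setT (EFin \o ((g j)^\- \o X j)%R).
  by have := integrable_funeneg measurableT igj; rewrite -funerneg.
have mp := measurable_funrpos (mg j); have mm := measurable_funrneg (mg j).
have ep := sub _ mp (funrpos_ge0 _) ip; have em := sub _ mm (funrneg_ge0 _) im.
rewrite [LHS](eq_integral (fun w => (\prod_(i in J) gs (g j)^\+ i (X i w))%:E -
   (\prod_(i in J) gs (g j)^\- i (X i w))%:E)%E); last first.
  move=> w _; rewrite -EFinB; congr EFin; rewrite !(bigD1 j jJ) /= {1 3}/gs eqxx.
  have e f : \prod_(i in J | i != j) gs f i (X i w) =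
             \prod_(i in J | i != j) g i (X i w).
    by apply: eq_bigr => i /andP[_ /negPf ij]; rewrite /gs ij.
  rewrite !e -mulrBl; congr (_ * _).
  by rewrite -{1}(funrposBneg (g j)).
rewrite integralB_EFin//; last 2 first.
- exact: int_of_fin (mgs _ mp) ep.
- exact: int_of_fin (mgs _ mm) em.
rewrite ep em -EFinB -mulrBl (bigD1 j jJ) /=; congr (_ * _)%:E.
rewrite -fineB ?integrable_fin_num//; apply: EFin_inj.
rewrite fineK; last by rewrite fin_numB !integrable_fin_num.
rewrite -integralB_EFin// -gm//; apply: eq_integral => w _.
by rewrite -EFinB -{3}(funrposBneg (g j)).
Qed.

Lemma expectation_prod_indep g m :
  (forall i, measurable_fun setT (g i)) ->
  (forall i, i \in J -> 'E_P[fun w => (g i (X i w))%R] = (m i)%:E)%E ->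
  ('E_P[fun w => (\prod_(i in J) g i (X i w))%R] = (\prod_(i in J) m i)%:E)%E.
Proof.
move=> mg gm; rewrite unlock.
apply: (@integral_prod (enum I)) => // [i _|i iJ]; first by rewrite mem_enum.
by rewrite -gm// unlock.
Qed.

End Product.

End Independence.

(** * Classes of equal hyperedges and the tensor entries they select *)

Section Edges.
Variables (p : nat) (g : hypergraph) (unif : uniform p g).
Local Notation F := (hedge_idx (forget_mult g)).

Definition edge_class (e : hedge_idx g) : F := SeqSub (codom_f (@hedge g) e).

Definition class_mult (f : F) : nat := @edge_mult g (hedge f).

Lemma class_multE f : class_mult f = #|[set e | edge_class e == f]%SET|.
Proof. by apply: eq_card => e; rewrite !inE -val_eqE. Qed.

Lemma class_mult_gt0 f : (0 < class_mult f)%N.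
Proof.
case: f => m mP; have /codomP[e me] := mP.
by apply/card_gt0P; exists e; rewrite inE /= me.
Qed.

Lemma class_mult_max f : (class_mult f <= #|hedge_idx g|)%N.
Proof. exact: max_card. Qed.

(** Classes are grouped by multiplicity, which is never 0 and at most the number of hyperedges, so
    the range of [r] misses no class. *)
Lemma hypertype_prod (R : comPzRingType) (M : nat -> R) :
  \prod_(1 <= r < #|hedge_idx g|.+1) M r ^+ hypertype g r =
  \prod_(f : F) M (class_mult f).
Proof.
pose c (f : F) : 'I_#|hedge_idx g|.+1 := inord (class_mult f).
have cE f : c f = class_mult f :> nat by rewrite inordK// ltnS class_mult_max.
have htE r : hypertype g r = #|[set f : F | class_mult f == r]%SET| by [].
rewrite [RHS](partition_big c xpredT)//= [RHS]big_ord_recl [X in X * _]big1 ?mul1r; last first.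
  by move=> f /eqP/(congr1 (@nat_of_ord _)); rewrite cE => c0; have := class_mult_gt0 f; rewrite c0.
rewrite big_add1 big_mkord; apply: eq_bigr => r _.
rewrite htE -prodr_const; apply: eq_big => [f|f].
  by rewrite inE -val_eqE /= cE.
by rewrite inE => /eqP ->.
Qed.

Variable N : nat.
Implicit Types phi : {ffun hvertex g -> 'I_N}.

Let size_edge phi (f : F) :
  size (sort (relpre val leq) [seq phi v | v <- hedge f]) == p.
Proof. by rewrite size_sort size_map (forget_mult_uniform unif). Qed.

(** Sorting selects, among the equal entries of a symmetric tensor, the one that belongs to the
    independent family. *)
Definition edge_tuple phi (f : F) : p.-tuple 'I_N := Tuple (size_edge phi f).

Lemma edge_tuple_perm phi f : perm_eq (edge_tuple phi f) [seq phi v | v <- hedge f].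
Proof. by rewrite /= perm_sort. Qed.

(** Equal tuples have equal multisets of indices, from which an injective [phi] recovers the
    vertices. Hence distinct classes read distinct entries. *)
Lemma edge_tuple_inj phi : injective phi -> injective (edge_tuple phi).
Proof.
move=> phi_inj f1 f2 /(congr1 (perm_eq^~ (edge_tuple phi f2) \o val)) /=.
rewrite perm_refl perm_sort perm_sym perm_sort => /(perm_map_inj phi_inj).
move=> /eq_seq_msetP; rewrite !seq_mset_id => e; exact/val_inj.
Qed.

Lemma edge_tuple_sorted phi f : sorted leq [seq val i | i <- edge_tuple phi f].
Proof. by rewrite sorted_map sort_sorted// => i j; exact: leq_total. Qed.

Lemma edge_tuple_strict phi f : injective phi -> uniq (hedge f) ->
  sorted ltn [seq val i | i <- edge_tuple phi f].
Proof.
move=> phi_inj uf; rewrite ltn_sorted_uniq_leq edge_tuple_sorted andbT.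
by rewrite (map_inj_uniq val_inj) sort_uniq map_inj_uniq.
Qed.

Lemma prod_tensor_entry (R : realType) (T : p.-tuple 'I_N -> R) phi :
  symmetric_tensor T ->
  \prod_(e : hedge_idx g) tensor_entry T [seq phi v | v <- hedge e] =
  \prod_(f : F) T (edge_tuple phi f) ^+ class_mult f.
Proof.
move=> symT; rewrite (partition_big edge_class xpredT)//=; apply: eq_bigr => f _.
rewrite class_multE -prodr_const; apply: eq_big => [e|e /eqP <-].
  by rewrite inE.
have sz : size [seq phi v | v <- hedge e] == p by rewrite size_map unif.
rewrite /tensor_entry insubT; apply: symT.
by rewrite perm_sym edge_tuple_perm.
Qed.

End Edges.

(** * Finite products of uniformly bounded or uniformly convergent families *)

Section UniformLimits.
Variables (R : realType) (F : Type) (A : nat -> Type) (S : forall N, A N -> Prop).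
Variable v : F -> forall N, A N -> R.

(** In the application [a] is a map from vertices to indices and [S] is injectivity. Uniformity in
    [a] matters because the number of maps grows with [N]. *)
Lemma prod_uniform_bounded (s : seq F) :
  (forall f, exists C : R, \forall N \near \oo, forall a : A N, S a -> `|v f a| <= C) ->
  exists C : R, \forall N \near \oo, forall a : A N, S a -> `|\prod_(f <- s) v f a| <= C.
Proof.
move=> vb; elim: s => [|f s [C sC]].
  by exists 1; near=> N => a _; rewrite big_nil normr1.
have [B fB] := vb f; exists (B * C); near=> N => a Sa.
rewrite big_cons normrM ler_pM//.
  suff : forall a : A N, S a -> `|v f a| <= B by apply.
  by near: N.
suff : forall a : A N, S a -> `|\prod_(f <- s) v f a| <= C by apply.
by near: N.
Unshelve. all: by end_near. Qed.

Lemma prod_uniform_cvg (m : F -> R) (s : seq F) :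
  (forall f (eps : R), 0 < eps ->
     \forall N \near \oo, forall a : A N, S a -> `|v f a - m f| <= eps) ->
  forall eps : R, 0 < eps ->
  \forall N \near \oo, forall a : A N, S a ->
    `|\prod_(f <- s) v f a - \prod_(f <- s) m f| <= eps.
Proof.
move=> vm; elim: s => [|f s IH] eps eps0.
  by near=> N => a _; rewrite !big_nil subrr normr0 ltW.
set L := \prod_(f <- s) m f.
(* These make each term of the decomposition below at most [eps / 2]. The 1 in the minimum bounds
   [Q] by [|L| + 1] in absolute value; the 1 in the denominators keeps them positive. *)
pose e1 := eps / 2 / (`|L| + 1); pose e2 := Num.min 1 (eps / 2 / (`|m f| + 1)).
have L1 : 0 < `|L| + 1 by rewrite ltr_wpDl.
have m1 : 0 < `|m f| + 1 by rewrite ltr_wpDl.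
have e10 : 0 < e1 by rewrite !divr_gt0.
have e20 : 0 < e2 by rewrite lt_min ltr01 !divr_gt0.
near=> N => a Sa; rewrite !big_cons -/L; set Q := \prod_(f <- s) v f a.
have h1 : `|v f a - m f| <= e1.
  suff : forall a : A N, S a -> `|v f a - m f| <= e1 by apply.
  by near: N; exact: vm.
have h2 : `|Q - L| <= e2.
  suff : forall a : A N, S a -> `|\prod_(f <- s) v f a - L| <= e2 by apply.
  by near: N; exact: IH.
have -> : v f a * Q - m f * L = (v f a - m f) * Q + m f * (Q - L).
  by rewrite mulrBl mulrBr addrA subrK.
have hQ : `|Q| <= `|L| + 1.
  rewrite -[Q](subrK L) (le_trans (ler_normD _ _))// addrC lerD2l.
  by rewrite (le_trans h2)// ge_min lexx.
rewrite (le_trans (ler_normD _ _))// !normrM [eps]splitr lerD//.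
  rewrite (le_trans (ler_pM _ _ h1 hQ))//.
  by rewrite /e1 mulfVK// gt_eqF.
rewrite (le_trans (ler_wpM2l _ h2))//.
rewrite (@le_trans _ _ ((`|m f| + 1) * (eps / 2 / (`|m f| + 1))))//.
  by rewrite ler_pM// ?(ltW e20)// ?lerDl// ge_min lexx orbT.
by rewrite mulrC mulfVK// gt_eqF.
Unshelve. all: by end_near. Qed.

End UniformLimits.

(** * Expectations of finite sums and subfamilies of independent variables *)

Section Expectations.
Context {R : realType} {d : measure_display} {Om : measurableType d}.
Variable P : probability Om R.

Lemma fin_expectation_integrable (Y : Om -> R) (r : R) :
  measurable_fun setT Y -> ('E_P[Y] = r%:E)%E -> P.-integrable setT (EFin \o Y).
Proof.
rewrite unlock => mY Yr; apply/integrableP; split; first exact/measurable_EFinP.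
by rewrite integral_fin_num_abs// Yr.
Qed.

Lemma expectation_scaled_sum (I : finType) (Q : pred I) (c : R)
    (Y : I -> Om -> R) (m : I -> R) :
  (forall i, measurable_fun setT (Y i)) ->
  (forall i, Q i -> 'E_P[Y i] = (m i)%:E)%E ->
  ('E_P[fun w => (c * \sum_(i | Q i) Y i w)%R] = (c * \sum_(i | Q i) m i)%:E)%E.
Proof.
move=> mY Ym.
(* Terms outside [Q] become zero, so that every summand is integrable. *)
pose Y' i w := if Q i then Y i w else 0; pose m' i := if Q i then m i else 0.
have Y'm i : ('E_P[Y' i] = (m' i)%:E)%E.
  by rewrite /Y' /m'; case: (boolP (Q i)) => [/Ym//|_]; exact: expectation_cst.
have iY' i : P.-integrable setT (fun w => (Y' i w)%:E).
  apply: fin_expectation_integrable (Y'm i).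
  by rewrite /Y'; case: (Q i) => //; exact: measurable_cst.
rewrite unlock (eq_integral (fun w => c%:E * \sum_i (Y' i w)%:E)%E).
  rewrite integralZl//; last by apply: integrable_sum => // i _.
  rewrite integral_sum// [in RHS]big_mkcond EFinM -sumEFin; congr (_ * _)%E.
  by apply: eq_bigr => i _; rewrite -Y'm unlock.
by move=> w _; rewrite EFinM [in LHS]big_mkcond -sumEFin.
Qed.

Lemma mutually_independent_inj (I F : finType) (D : {set I})
    (X : I -> {RV P >-> R}) (s : F -> I) :
  mutually_independent D X -> injective s -> (forall f, s f \in D) ->
  mutually_independent [set: F]%SET (X \o s).
Proof.
move=> indep s_inj sD J B _ mB.
(* As [s] is injective, [pick] finds the only preimage; [setT] is a default value off the image. *)
pose B' i := if [pick f | s f == i] is Some f then B f else setT.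
have B's f : B' (s f) = B f.
  by rewrite /B'; case: pickP => [f' /eqP/s_inj ->//|/(_ f)]; rewrite eqxx.
have sJD : s @: J \subset D by apply/fintype.subsetP => _ /imsetP[f _ ->].
have := indep (s @: J) B' sJD; rewrite big_imset/=; last by move=> ? ? _ _ /s_inj.
under eq_bigr do rewrite B's.
move=> <-; last by move=> _ /imsetP[f fJ ->]; rewrite B's; exact: mB.
congr (P _); apply/seteqP; split => w /= wB.
  by move=> _ /= /imsetP[f fJ ->] /=; rewrite B's; exact: (wB f).
move=> f /= fJ; have := wB (s f); rewrite /= B's; apply.
exact: imset_f.
Qed.

End Expectations.

(** * Heavy-Wigner traces *)

Lemma cvg_natr_inv (R : realType) : (N%:R^-1 : R) @[N --> \oo] --> (0 : R).
Proof. by rewrite -cvg_shiftS; exact: cvg_harmonic. Qed.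

(** This is the proportion of injective maps among all maps from [m] points to [N]; adding a point
    multiplies it by [1 - m / N]. *)
Lemma cvg_ffact_ratio (R : realType) (m : nat) :
  ((N ^_ m)%:R / N%:R ^+ m : R) @[N --> \oo] --> (1 : R).
Proof.
elim: m => [|m IH].
  under eq_fun do rewrite ffactn0 expr0 divr1.
  exact: cvg_cst.
have fac : (1 - m%:R * N%:R^-1 : R) @[N --> \oo] --> (1 : R).
  rewrite -[X in _ --> X]subr0 -[X in _ - X](mulr0 m%:R).
  by apply: cvgB; [exact: cvg_cst|apply: cvgMr; exact: cvg_natr_inv].
rewrite -[X in _ --> X]mulr1.
apply: cvg_trans (cvgM IH fac); apply: near_eq_cvg; near=> N.
have N0 : (0 < N)%N by near: N; exact: nbhs_infty_gt.
have mN : (m <= N)%N by near: N; exact: nbhs_infty_ge.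
rewrite /= ffactnSr natrM natrB// exprSr.
have NR : N%:R != 0 :> R by rewrite pnatr_eq0 -lt0n.
by field; rewrite NR expf_neq0.
Unshelve. all: by end_near. Qed.

Lemma expn_ge_ffact N m : (N ^_ m <= N ^ m)%N.
Proof. by elim: m => // m IH; rewrite ffactnSr expnSr leq_mul// leq_subr. Qed.

Lemma sum_const_injective (R : pzRingType) (V : finType) N (c : R) :
  \sum_(phi : {ffun V -> 'I_N} | injectiveb phi) c = (N ^_ #|V|)%:R * c.
Proof.
rewrite sumr_const mulr_natl; congr (_ *+ _).
rewrite -[X in (X ^_ _)%N]card_ord -card_inj_ffuns.
by apply: eq_card => phi; rewrite inE.
Qed.

Lemma normr_sum_injective (R : realType) (V : finType) N
    (x : {ffun V -> 'I_N} -> R) (C : R) :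
  (forall phi : {ffun V -> 'I_N}, injective phi -> `|x phi| <= C) ->
  `|\sum_(phi : {ffun V -> 'I_N} | injectiveb phi) x phi| <= (N ^_ #|V|)%:R * C.
Proof.
move=> xC; rewrite -sum_const_injective; apply: le_trans (ler_norm_sum _ _ _) _.
by apply: ler_sum => phi /injectiveP /xC.
Qed.

(** * Finiteness, bounds and limits of the entry moments *)

Section Moments.
Variables (R : realType) (p : nat) (M : nat -> R) (d : nat -> measure_display).
Variables (Om : forall N, measurableType (d N)) (P : forall N, probability (Om N) R).
Variable T : forall N, p.-tuple 'I_N -> {RV (P N) >-> R}.
Hypothesis hT : heavy_wigner M T.

Definition entry_moment N (t : p.-tuple 'I_N) (k : nat) : R :=
  fine ('E_(P N)[fun w => (T t w ^+ k)%R])%E.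

Let moment1 N (t : p.-tuple 'I_N) : ('E_(P N)[fun w => (T t w ^+ 1)%R] = 0)%E.
Proof. exact: (hw_centered hT). Qed.

(** Order 1 is the centering. At higher orders an infinite moment, multiplied by a positive power of
    [N], would violate the uniform bound. *)
Lemma entry_moment_fin k : (0 < k)%N -> \forall N \near \oo, forall t,
  ('E_(P N)[fun w => (T t w ^+ k)%R] = (entry_moment t k)%:E)%E.
Proof.
case: k => [//|[|k]] _.
  by near=> N => t; rewrite /entry_moment moment1.
have [C bC] := hw_bound hT (isT : (2 <= k.+2)%N).
near=> N => t; rewrite fineK//.
have N0 : (0 < N)%N by near: N; exact: nbhs_infty_gt.
have : (`| ((N%:R ^+ p.-1)%R%:E * 'E_(P N)[fun w => (T t w ^+ k.+2)%R])%E | <= C%:E)%E.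
  by move: t; near: N.
case: ('E_(P N)[_])%E => //=.
  by rewrite mulry gtr0_sg ?exprn_gt0 ?ltr0n// mul1e /= leye_eq.
by rewrite mulrNy gtr0_sg ?exprn_gt0 ?ltr0n// mul1e /= leye_eq.
Unshelve. all: by end_near. Qed.

Lemma scaled_moment_bounded k : (0 < k)%N -> exists C : R,
  \forall N \near \oo, forall t, `|N%:R ^+ p.-1 * entry_moment (t : p.-tuple 'I_N) k| <= C.
Proof.
case: k => [//|[|k]] k0.
  by exists 0; near=> N => t; rewrite /entry_moment moment1 /= mulr0 normr0.
have [C bC] := hw_bound hT (isT : (2 <= k.+2)%N).
exists C; near=> N => t.
rewrite -lee_fin -abse_EFin EFinM.
have <- : ('E_(P N)[fun w => (T t w ^+ k.+2)%R] = (entry_moment t k.+2)%:E)%E.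
  by move: t; near: N; exact: entry_moment_fin.
by move: t; near: N.
Unshelve. all: by end_near. Qed.

Lemma scaled_moment_cvg k : (0 < k)%N -> forall eps : R, 0 < eps ->
  \forall N \near \oo, forall t : p.-tuple 'I_N, sorted ltn [seq val i | i <- t] ->
    `|N%:R ^+ p.-1 * entry_moment t k - M k| <= eps.
Proof.
case: k => [//|[|k]] k0 eps eps0.
  (* At order 1 the moment and [M 1] both vanish. *)
  near=> N => t _.
  by rewrite /entry_moment moment1 /= (hw_param1 hT) mulr0 subrr normr0 ltW.
have bC := hw_moments hT (isT : (2 <= k.+2)%N) eps0.
near=> N => t st.
rewrite -lee_fin -abse_EFin EFinB EFinM.
have <- : ('E_(P N)[fun w => (T t w ^+ k.+2)%R] = (entry_moment t k.+2)%:E)%E.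
  by move: t {st}; near: N; exact: entry_moment_fin.
move: t st; near: N.
Unshelve. all: by end_near. Qed.

(** * The expected trace and its limit *)

Section Trace.
Variables (g : hypergraph) (unif : uniform p g).
Local Notation F := (hedge_idx (forget_mult g)).

Definition tr0_moment N : R :=
  N%:R^-1 * \sum_(phi : {ffun hvertex g -> 'I_N} | injectiveb phi)
              \prod_(f : F) entry_moment (edge_tuple unif phi f) (class_mult f).

(** Stated for large [N], where the moments are finite; as there are finitely many classes, one
    threshold serves them all. *)
Lemma expectation_tr0 : \forall N \near \oo,
  ('E_(P N)[fun w => tr0 g (fun t => T t w)] = (tr0_moment N)%:E)%E.
Proof.
have fin : \forall N \near \oo, forall f : F, forall t,
    ('E_(P N)[fun w => (T t w ^+ class_mult f)%R] =
     (entry_moment t (class_mult f))%:E)%E.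
  by apply: filter_forall => f; apply: entry_moment_fin; exact: class_mult_gt0.
near=> N.
have finN : forall (f : F) t,
    ('E_(P N)[fun w => (T t w ^+ class_mult f)%R] =
     (entry_moment t (class_mult f))%:E)%E by near: N.
have -> : (fun w => tr0 g (fun t => T t w)) = (fun w => N%:R^-1 *
    \sum_(phi : {ffun hvertex g -> 'I_N} | injectiveb phi)
      \prod_(f : F) T (edge_tuple unif phi f) w ^+ class_mult f).
  apply/funext => w; rewrite /tr0 /Tr0; congr (_ * _); apply: eq_bigr => phi _.
  by apply: prod_tensor_entry => t u; exact: (hw_sym hT).
have mpow (f : F) : measurable_fun setT (fun x : R => x ^+ class_mult f).
  exact: measurable_funX.
apply: expectation_scaled_sum => [phi|phi /injectiveP phi_inj].
  apply: measurable_prod => f _.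
  exact: (measurableT_comp (mpow f)).
have sorted_et (f : F) : edge_tuple unif phi f \in
    [set t : p.-tuple 'I_N | sorted leq [seq val i | i <- t]]%SET.
  by rewrite inE edge_tuple_sorted.
have indep := mutually_independent_inj (hw_indep hT (N := N))
  (edge_tuple_inj (unif := unif) phi_inj) sorted_et.
have := expectation_prod_indep indep (fintype.subxx _) (g := fun f x => x ^+ class_mult f)
  (m := fun f => entry_moment (edge_tuple unif phi f) (class_mult f)) mpow.
rewrite (eq_bigl xpredT) => [|f]; last by rewrite inE.
have -> : (fun w : Om N => \prod_(i in [set: F]%SET)
    (@T N \o edge_tuple unif phi) i w ^+ class_mult i) =
  (fun w => \prod_(f : F) T (edge_tuple unif phi f) w ^+ class_mult f).
  by apply/funext => w; apply: eq_bigl => f; rewrite inE.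
by apply => f _; exact: finN.
Unshelve. all: by end_near. Qed.

(** Each class takes a factor [N ^ (p - 1)], which keeps its moment bounded; the extra 1 in the
    exponent is the normalization of the trace. *)
Lemma tr0_moment_scaled N : (0 < N)%N ->
  tr0_moment N = (N%:R ^+ (p.-1 * #|F|).+1)^-1 *
    \sum_(phi : {ffun hvertex g -> 'I_N} | injectiveb phi)
      \prod_(f : F) (N%:R ^+ p.-1 * entry_moment (edge_tuple unif phi f) (class_mult f)).
Proof.
move=> N0; rewrite /tr0_moment exprS invfM -mulrA; congr (_ * _).
rewrite mulr_sumr; apply: eq_bigr => phi _.
rewrite big_split /= prodr_const cardT -cardE -exprM mulrA mulVf ?mul1r//.
by rewrite expf_neq0// pnatr_eq0 -lt0n.
Qed.

Let v (f : F) N (phi : {ffun hvertex g -> 'I_N}) : R :=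
  N%:R ^+ p.-1 * entry_moment (edge_tuple unif phi f) (class_mult f).

Hypotheses (p_gt0 : (0 < p)%N) (conn : connected_hypergraph g).

(** For a fat hypertree the prefactor is exactly the inverse of [N ^ V]: up to a ratio tending to 1,
    the trace averages products that converge uniformly to [L]. *)
Lemma tr0_moment_cvg_fat : fat_hypertree g ->
  tr0_moment N @[N --> \oo] --> \prod_(f : F) M (class_mult f).
Proof.
move=> fat; set L := \prod_(f : F) _.
have VE : (p.-1 * #|F|).+1 = #|hvertex g|.
  have /(fat_hypertree_cardP unif conn) := fat.
  by case: p p_gt0 => //= p' _; rewrite mulSn; lia.
pose ratio N : R := (N ^_ #|hvertex g|)%:R / N%:R ^+ #|hvertex g|.
have vcvg := @prod_uniform_cvg R F _
  (fun N (phi : {ffun hvertex g -> 'I_N}) => injective phi) v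
  (fun f => M (class_mult f)) (index_enum F).
(* Subtracting [L] once per injective map leaves at most [N ^ V] terms, each bounded by [eps],
   divided by [N ^ V]. *)
have dcvg : (tr0_moment N - L * ratio N) @[N --> \oo] --> (0 : R).
  apply/cvgrPdist_le => eps eps0; near=> N.
  have N0 : (0 < N)%N by near: N; exact: nbhs_infty_gt.
  have vN : forall phi : {ffun hvertex g -> 'I_N}, injective phi ->
      `|\prod_(f : F) v f phi - L| <= eps.
    near: N; apply: vcvg => // f e e0.
    apply: filterS (scaled_moment_cvg (class_mult_gt0 f) e0) => N vN phi phi_inj.
    by apply: vN; apply: edge_tuple_strict => //; by have [[_ ->]] := fat.
  rewrite sub0r normrN tr0_moment_scaled// VE.
  rewrite /ratio mulrA [_ / _]mulrC -mulrBr [L * _]mulrC -sum_const_injective -sumrB.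
  have NV : 0 < N%:R ^+ #|hvertex g| :> R by rewrite exprn_gt0// ltr0n.
  rewrite normrM ger0_norm ?invr_ge0 ?(ltW NV)// ler_pdivrMl//.
  apply: le_trans (normr_sum_injective vN) _; rewrite ler_wpM2r ?(ltW eps0)//.
  by rewrite -natrX ler_nat expn_ge_ffact.
rewrite (_ : tr0_moment = fun N => (tr0_moment N - L * ratio N) + L * ratio N).
  rewrite -[X in _ --> X]add0r -[X in _ + X](mulr1 L).
  by apply: cvgD => //; apply: cvgMr; exact: cvg_ffact_ratio.
by apply/funext => N; rewrite subrK.
Unshelve. all: by end_near. Qed.

(** The counting bound is now strict, so V is at most (p - 1)F, and a sum of at most [N ^ V] bounded
    terms leaves a factor [1 / N]. *)
Lemma tr0_moment_cvg_nonfat : ~ fat_hypertree g ->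
  tr0_moment N @[N --> \oo] --> (0 : R).
Proof.
move=> nfat.
have VE : (#|hvertex g| <= p.-1 * #|F|)%N.
  have cg := hypergraph_card_leq (forget_mult_uniform unif) (forget_mult_connected conn).
  have {nfat} ne : (#|hvertex g| + #|F|)%N != (p * #|F| + 1)%N.
    by apply/eqP => /(fat_hypertree_cardP unif conn).
  move: cg ne; case: p p_gt0 => //= p' _; rewrite mulSn; lia.
have [f|C bC] := @prod_uniform_bounded R F _
    (fun N (phi : {ffun hvertex g -> 'I_N}) => injective phi) v (index_enum F).
  have [C bC] := scaled_moment_bounded (class_mult_gt0 f).
  by exists C; apply: filterS bC => N vN phi _; exact: vN.
have Ccvg : (`|C| * N%:R^-1 : R) @[N --> \oo] --> (0 : R).
  by rewrite -[X in _ --> X](mulr0 `|C|); apply: cvgMr; exact: cvg_natr_inv.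
apply/cvgrPdist_le => eps eps0; near=> N.
have N0 : (0 < N)%N by near: N; exact: nbhs_infty_gt.
have vN : forall phi : {ffun hvertex g -> 'I_N}, injective phi ->
    `|\prod_(f : F) v f phi| <= `|C|.
  near: N; apply: filterS bC => N vN phi /vN vC.
  by apply: le_trans vC _; exact: ler_norm.
rewrite sub0r normrN tr0_moment_scaled//.
have NV : 0 < N%:R ^+ (p.-1 * #|F|) :> R by rewrite exprn_gt0// ltr0n.
apply: (@le_trans _ _ (`|C| * N%:R^-1)).
  rewrite exprS invfM -mulrA normrM ger0_norm ?invr_ge0// [leRHS]mulrC.
  rewrite ler_wpM2l ?invr_ge0//.
  rewrite normrM ger0_norm ?invr_ge0 ?(ltW NV)// ler_pdivrMl//.
  apply: le_trans (normr_sum_injective vN) _; rewrite ler_wpM2r//.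
  rewrite -natrX ler_nat; apply: leq_trans (expn_ge_ffact _ _) _.
  by rewrite leq_pexp2l.
suff : `|0 - `|C| * N%:R^-1| <= eps.
  by apply: le_trans; rewrite sub0r normrN; exact: ler_norm.
by near: N; move/cvgrPdist_le: Ccvg => /(_ eps eps0).
Unshelve. all: by end_near. Qed.

Lemma expectation_tr0_cvg :
  ('E_(P N)[fun w => tr0 g (fun t => T t w)])%E @[N --> \oo] -->
  ((`[< fat_hypertree g >])%:R *
   \prod_(1 <= r < #|hedge_idx g|.+1) M r ^+ hypertype g r)%:E.
Proof.
(* Convergence to a finite limit in the extended reals amounts to eventual finiteness and
   convergence of the real values. *)
rewrite hypertype_prod; apply/fine_cvgP; split.
  by apply: filterS expectation_tr0 => N ->.
apply: (cvg_trans (G := tr0_moment N @[N --> \oo])).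
  by apply: near_eq_cvg; apply: filterS expectation_tr0 => N /= ->.
case: asboolP => [fat|nfat]; first by rewrite mul1r; exact: tr0_moment_cvg_fat.
by rewrite mul0r; exact: tr0_moment_cvg_nonfat.
Qed.

End Trace.
End Moments.

Theorem theorem1p3 (R : realType) (p : nat) (hp : (2 <= p)%N)
    (h : hypergraph) (hconn : connected_hypergraph h) (hunif : uniform p h)
    (Q : {set {set hvertex h}}) (hQ : finset.partition Q [set: hvertex h]%SET)
    (M : nat -> R) (d : nat -> measure_display)
    (Om : forall N, measurableType (d N))
    (P : forall N, probability (Om N) R)
    (T : forall N, p.-tuple 'I_N -> {RV (P N) >-> R})
    (hT : heavy_wigner M T) :
  ('E_(P N)[fun w => tr0 (hquotient hQ) (fun t => T N t w)])%E @[N --> \oo] -->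
  ((`[< fat_hypertree (hquotient hQ) >])%:R *
   \prod_(1 <= r < #|hedge_idx h|.+1) M r ^+ hypertype (hquotient hQ) r)%:E.
Proof.
(* Identifying vertices keeps the index type of the hyperedges, so the range of [r] is the same for
   [h] and its quotient. *)
apply: (expectation_tr0_cvg hT) (ltnW hp) _.
  exact: hquotient_uniform.
exact: hquotient_connected.
Qed.
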